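(* Let $\{J,J'\}$ be a good system in $\Phi$. The $K\mathcal{W}$-module $$D^{\Delta,\Delta'}=S^{\Delta,\Delta'}/\bigl(S^{\Delta,\Delta'}\cap (S^{\Delta,\Delta'})^{\perp}\bigr)$$ is zero or irreducible, where $(S^{\Delta,\Delta'})^{\perp}$ is the orthogonal complement of $S^{\Delta,\Delta'}$ in $M^{\Delta}$ with respect to the bilinear form $\langle\,,\rangle$.
   Context: Root systems: $\Phi$ is a root system (finite, reduced, crystallographic) in a finite-dimensional real Euclidean space $V$, with simple system $\pi$ and corresponding positive system $\Phi^{+}$; $\mathcal{W}$ is its Weyl group, generated by the reflections $\tau_\alpha$ ($\alpha\in\Phi$). $l(w)$ is the length of $w$ with respect to $\pi$ and $s(w)=(-1)^{l(w)}$. A subsystem of $\Phi$ is a subset which is itself a root system in the space it spans (the empty set is allowed). A subsystem $\Psi$ is additively closed if $\alpha,\beta\in\Psi$ and $\alpha+\beta\in\Phi$ imply $\alpha+\beta\in\Psi$. Useful systems: $\Psi$ is an additively closed subsystem of $\Phi$ with simple system $J\subset\Phi^{+}$, and $\Psi'$ is a subsystem with $\Psi'\subseteq\Phi\setminus\Psi$ and simple system $J'\subset\Phi^{+}$. $\mathcal{W}(J)$ is the subgroup generated by $\tau_\alpha$, $\alpha\in\Psi$; similarly $\mathcal{W}(J')$, and $\mathcal{W}(wJ)=w\mathcal{W}(J)w^{-1}$, $\mathcal{W}(wJ')=w\mathcal{W}(J')w^{-1}$ for $w\in\mathcal{W}$. $\Psi^{\perp}$ (resp. $\Psi'^{\perp}$)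 is the largest subsystem of $\Phi$ orthogonal to $\Psi$ (resp. $\Psi'$), with simple system $J^{\perp}\subset\Phi^+$ (resp. $J'^{\perp}\subset\Phi^+$), and $\mathcal{W}(J^\perp)$, $\mathcal{W}(J'^\perp)$ are the corresponding reflection subgroups. $\{J,J'\}$ is a useful system if $\mathcal{W}(J)\cap\mathcal{W}(J')=\langle e\rangle$ and $\mathcal{W}(J^{\perp})\cap\mathcal{W}(J'^{\perp})=\langle e\rangle$. Tableaux and tabloids: fix orderings of the elements of $J$ and of $J'$ and let $\bar J$ be the resulting ordered tuple of roots (elements of $J$, then of $J'$). The $\Delta$-tableaux are the $w\bar J$, $w\in\mathcal{W}$. Two $\Delta$-tableaux $w_1\bar J$, $w_2\bar J$ are row-equivalent if $w_2\bar J=\rho w_1\bar J$ for some $\rho\in\mathcal{W}(w_1J)$. The equivalence class of $w\bar J$ is the $\Delta$-tabloid $\{w\bar J\}$. $\mathcal{W}$ acts on tabloids by $\sigma\{w\bar J\}=\{\sigma w\bar J\}$. Modules: $K$ is an arbitrary field; $M^{\Delta}$ is the $K$-space with basis the $\Delta$-tabloids, a $K\mathcal{W}$-module by linear extension. $\kappa_{J'}=\sum_{\sigma\in\mathcal{W}(J')}s(\sigma)\sigma$, $e_{J,J'}=\kappa_{J'}\{\bar J\}$, and for $w\in\mathcal{W}$, $e_{wJ,wJ'}=\kappa_{wJ'}\{w\bar J\}=w\,e_{J,J'}$. The generalized Specht module $S^{\Delta,\Delta'}$ is the $K$-subspace of $M^\Delta$ spanned by all $e_{wJ,wJ'}$,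 $w\in\mathcal{W}$ (it is a $K\mathcal{W}$-submodule). Good systems: $D_{\Psi}=\{w\in\mathcal{W}: w(j)\in\Phi^{+}\text{ for all }j\in J\}$. A useful system $\{J,J'\}$ is a good system if for every $d\in D_\Psi$ with $d\Psi\cap\Psi'=\emptyset$, the tabloid $\{d\bar J\}$ appears with non-zero coefficient in $e_{J,J'}$. Form: $\langle\,,\rangle$ is the bilinear form on $M^\Delta$ for which $\langle t_1,t_2\rangle=1$ if $t_1=t_2$ and $0$ otherwise, for $\Delta$-tabloids $t_1,t_2$. *)

(* Defs.v *)
From mathcomp Require Import all_boot all_order all_fingroup all_algebra.
From mathcomp Require Import archimedean sesquilinear.
From mathcomp Require Import mxrepresentation.
From mathcomp Require Import finmap.
From mathcomp Require Import boolp reals.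

Set Implicit Arguments.
Unset Strict Implicit.
Unset Printing Implicit Defensive.

Import Order.TTheory GRing.Theory Num.Theory.
Local Open Scope ring_scope.

Section RootSystems.

Variables (R : realType) (V : vectType R) (B : {dot V for idfun}).

Definition reflection (a x : V) : V := x - (2 * B x a / B a a) *: a.

Definition is_root_system (U : {vspace V}) (S : seq V) : Prop :=
  [/\ <<S>>%VS = U,
      0 \notin S,
      {in S &, forall a b, reflection a b \in S},
      {in S, forall a (c : R), c *: a \in S -> c = 1 \/ c = -1} &
      {in S &, forall a b, 2 * B b a / B a a \is a Num.int}].

Structure rootSystem := RootSystem {
  roots :> {fset V};
  rootsP : is_root_system fullv roots }.

Variable Phi : rootSystem.
Implicit Types (a b : Phi) (A Psi : {set Phi}) (pi D : seq Phi).

Definition vecs A : seq V := [seq val a | a in A].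

Definition subsystem Psi : Prop := is_root_system <<vecs Psi>>%VS (vecs Psi).

Definition additively_closed Psi : Prop :=
  forall a b c : Phi,
    a \in Psi -> b \in Psi -> val c = val a + val b -> c \in Psi.

Definition nonneg_comb D (v : V) : Prop :=
  exists2 c : Phi -> R,
    {in D, forall a, 0 <= c a} & v = \sum_(a <- D) c a *: val a.

(* Simple systems are given together with an ordering of their elements;
   [free] forbids repetitions. *)
Definition simple_system Psi D : Prop :=
  [/\ {subset D <= Psi},
      free [seq val a | a <- D] &
      {in Psi, forall b, nonneg_comb D (val b) \/ nonneg_comb D (- val b)}].

Definition positive pi a : Prop := nonneg_comb pi (val a).

Lemma reflectionK (a : V) : a != 0 -> involutive (reflection a).
Proof.
move=> a0 x; rewrite /reflection.
have Ba : B a a != 0 by rewrite gt_eqF // neq0_dnorm_gt0.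
set c := 2 * B x a / B a a.
have -> : B (x - c *: a) a = - B x a.
  rewrite linearBl linearZl_LR /= /c divfK //.
  by rewrite mulr_natl mulr2n opprD addrA subrr add0r.
by rewrite mulrN mulNr scaleNr opprK subrK.
Qed.

Lemma root_neq0 a : val a != 0.
Proof.
have [_ n0 _ _ _] := rootsP Phi.
by apply: contraNneq n0 => <-; exact: valP.
Qed.

Lemma reflection_root a b : reflection (val a) (val b) \in roots Phi.
Proof. by have [_ _ + _ _] := rootsP Phi; apply; exact: valP. Qed.

Definition refl_root a b : Phi := [` reflection_root a b]%fset.

Lemma refl_rootK a : involutive (refl_root a).
Proof. by move=> b; apply/val_inj/reflectionK/root_neq0. Qed.

(* As Phi spans V, a linear map stabilising Phi is determined by the
   permutation of Phi it induces; the Weyl group is represented by these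
   permutations.  In {perm Phi}, [(s * t)%g] is the map "s, then t", i.e. the
   composite t \o s; thus the conjugate [A :^ w] is the set of the
   w \o s \o w^-1 for s in A, and [(w * s)%g] is the Weyl group element s w. *)
Definition tau a : {perm Phi} := perm (inv_inj (refl_rootK a)).

Definition refl_group A : {group {perm Phi}} := [group of <<(tau @: A)%SET>>%g].

Definition weyl : {group {perm Phi}} := refl_group setT.

Section Length.
Local Open Scope group_scope.

(* [S ^+ k] is the set of all products of k elements of S. *)
Definition simple_word pi (w : {perm Phi}) (k : nat) : bool :=
  w \in [set tau a | a in pi] ^+ k.

(* The default value 0 is never used when pi is a simple system and w is in
   the Weyl group. *)
Definition length pi w : nat :=
  if pselect (exists k, simple_word pi w k) is left h then ex_minn h else 0.
End Length.

Definition perp Psi : {set Phi} :=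
  [set a | [forall b in Psi, B (val a) (val b) == 0]].

Lemma mem_vecs A a : (val a \in vecs A) = (a \in A).
Proof.
apply/imageP/idP => [[b bA /val_inj ->] //|aA]; by exists a.
Qed.

Lemma subsystem_perp Psi : subsystem (perp Psi).
Proof.
have vP (v : V) : v \in vecs (perp Psi) -> exists2 a, a \in perp Psi & v = val a.
  by move=> /imageP[a aP ->]; exists a.
have [_ _ _ hred hcrys] := rootsP Phi.
split=> //.
- by apply/negP => /vP[a _ /esym/eqP]; rewrite (negPf (root_neq0 a)).
- move=> _ _ /vP[a aP ->] /vP[b bP ->].
  rewrite -[reflection _ _]/(val (refl_root a b)) mem_vecs.
  move: aP bP; rewrite !inE => /forall_inP aP /forall_inP bP.
  apply/forall_inP => c cP /=; rewrite /reflection linearBl linearZl_LR /=.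
  by rewrite (eqP (aP c cP)) (eqP (bP c cP)) mulr0 subrr.
- move=> _ /vP[a aP ->] c /vP[b bP e]; apply: (hred (val a) (valP a) c).
  by rewrite e; exact: valP.
- by move=> _ _ /vP[a _ ->] /vP[b _ ->]; apply: hcrys; exact: valP.
Qed.

Lemma perp_largest Psi A :
  (forall a b, a \in A -> b \in Psi -> B (val a) (val b) = 0) ->
  A \subset perp Psi.
Proof.
move=> h; apply/subsetP => a aA; rewrite inE; apply/forall_inP => b bP.
by apply/eqP/h.
Qed.

Record useful_system pi (Psi Psi' : {set Phi}) (J J' : seq Phi) : Prop := {
  useful_sub : subsystem Psi;
  useful_closed : additively_closed Psi;
  useful_simple : simple_system Psi J;
  useful_pos : {in J, forall a, positive pi a};
  useful_sub' : subsystem Psi';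
  useful_compl : Psi' \subset ~: Psi;
  useful_simple' : simple_system Psi' J';
  useful_pos' : {in J', forall a, positive pi a};
  useful_trivI : refl_group Psi :&: refl_group Psi' = 1%g;
  useful_perp_trivI :
    refl_group (perp Psi) :&: refl_group (perp Psi') = 1%g }.

Section Tabloids.

Variables (K : fieldType) (pi : seq Phi) (Psi Psi' : {set Phi}) (J J' : seq Phi).

Definition Jbar : (size (J ++ J')).-tuple Phi := in_tuple (J ++ J').

Definition act_tableau (s : {perm Phi}) (t : (size (J ++ J')).-tuple Phi) :=
  map_tuple s t.

Definition tableau w := act_tableau w Jbar.

Definition tableaux : {set (size (J ++ J')).-tuple Phi} :=
  [set tableau w | w in weyl].

Definition row_equiv : rel ((size (J ++ J')).-tuple Phi) := fun t1 t2 =>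
  [exists w1 in weyl, exists w2 in weyl,
    [&& t1 == tableau w1, t2 == tableau w2 &
        [exists rho in (refl_group Psi :^ w1)%g,
           tableau w2 == act_tableau rho (tableau w1)]]].

Definition tabloid w : {set (size (J ++ J')).-tuple Phi} :=
  [set t in tableaux | row_equiv (tableau w) t].

Definition tabloids : {set {set (size (J ++ J')).-tuple Phi}} :=
  [set tabloid w | w in weyl].

Definition act_tabloid (s : {perm Phi})
    (T : {set (size (J ++ J')).-tuple Phi}) := act_tableau s @: T.

Lemma act_tableauM s t x :
  act_tableau (s * t)%g x = act_tableau t (act_tableau s x).
Proof.
by apply: eq_from_tnth => i; rewrite !tnth_map permM.
Qed.

Lemma act_tableau1 x : act_tableau 1%g x = x.
Proof. by apply: eq_from_tnth => i; rewrite !tnth_map perm1. Qed.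

Lemma act_tabloidM s t T :
  act_tabloid (s * t)%g T = act_tabloid t (act_tabloid s T).
Proof.
by rewrite /act_tabloid -imset_comp; apply: eq_imset => x; exact: act_tableauM.
Qed.

Lemma act_tabloid1 T : act_tabloid 1%g T = T.
Proof.
by rewrite -[RHS]imset_id; apply: eq_imset => x; exact: act_tableau1.
Qed.

Lemma row_equiv_act s t1 t2 :
  s \in weyl -> row_equiv t1 t2 ->
  row_equiv (act_tableau s t1) (act_tableau s t2).
Proof.
move=> sW /exists_inP[w1 w1W /exists_inP[w2 w2W /and3P[/eqP-> /eqP-> ]]].
move=> /exists_inP[rho rhoP /eqP e].
apply/exists_inP; exists (w1 * s)%g; first by rewrite groupM.
apply/exists_inP; exists (w2 * s)%g; first by rewrite groupM.
rewrite /tableau !act_tableauM !eqxx /=; apply/exists_inP.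
exists (rho ^ s)%g; first by rewrite conjsgM memJ_conjg.
by rewrite -!/(tableau _) e -!act_tableauM conjgE mulKVg.
Qed.

Lemma act_tabloidE s w :
  s \in weyl -> act_tabloid s (tabloid w) = tabloid (w * s)%g.
Proof.
move=> sW.
have sub r v : r \in weyl -> act_tabloid r (tabloid v) \subset tabloid (v * r)%g.
  move=> rW; apply/subsetP => _ /imsetP[t + ->].
  rewrite !inE => /andP[/imsetP[u uW ->] h]; rewrite {2}/tableau act_tableauM.
  rewrite row_equiv_act // andbT; apply/imsetP; exists (u * r)%g.
    by rewrite groupM.
  by rewrite /tableau act_tableauM.
apply/eqP; rewrite eqEsubset sub //= -[tabloid (w * s)]act_tabloid1.
rewrite -(mulVg s) act_tabloidM imsetS //.
by apply: subset_trans (sub _ _ _) _; rewrite ?groupV // mulgK.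
Qed.

Lemma act_tabloid_mem s T :
  s \in weyl -> T \in tabloids -> act_tabloid s T \in tabloids.
Proof.
move=> sW /imsetP[w wW ->]; rewrite act_tabloidE //.
by apply: imset_f; rewrite groupM.
Qed.

Lemma tabloid1_mem : tabloid 1%g \in tabloids.
Proof. by apply: imset_f; exact: group1. Qed.

(* Basis index of a tabloid (a default index for other sets). *)
Definition tabloid_rank (T : {set (size (J ++ J')).-tuple Phi}) :
  'I_#|tabloids| := enum_rank_in tabloid1_mem T.

(* The elements of the permutation module are row vectors indexed by the
   tabloids; w acts by right multiplication by the matrix sending the basis
   vector of T to that of w T. *)
Definition tabloid_mx (s : {perm Phi}) : 'M[K]_#|tabloids| :=
  \matrix_(i, j) (act_tabloid s (enum_val i) == enum_val j)%:R.

Lemma tabloid_mx_repr : mx_repr weyl tabloid_mx.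
Proof.
split=> [|s t sW tW]; apply/matrixP => i j.
  by rewrite !mxE act_tabloid1 (inj_eq enum_val_inj).
rewrite !mxE act_tabloidM.
have sT := act_tabloid_mem sW (enum_valP i).
have e : enum_val (tabloid_rank (act_tabloid s (enum_val i)))
         = act_tabloid s (enum_val i) by exact: enum_rankK_in.
rewrite (bigD1 (tabloid_rank (act_tabloid s (enum_val i)))) //= !mxE e eqxx mul1r.
rewrite big1 ?addr0 // => k kn; rewrite !mxE -e (inj_eq enum_val_inj) eq_sym.
by rewrite (negPf kn) mul0r.
Qed.

Definition tabloid_repr : mx_representation K weyl #|tabloids| :=
  MxRepresentation tabloid_mx_repr.

Definition tabloid_vec (T : {set (size (J ++ J')).-tuple Phi}) :
  'rV[K]_#|tabloids| := delta_mx 0 (tabloid_rank T).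

Lemma tabloid_vec_act s w : s \in weyl -> w \in weyl ->
  tabloid_vec (tabloid w) *m tabloid_repr s = tabloid_vec (tabloid (w * s)%g).
Proof.
move=> sW wW; rewrite -rowE; apply/rowP => j; rewrite !mxE /= !enum_rankK_in ?imset_f //.
rewrite act_tabloidE // [j == _]eq_sym -(inj_eq enum_val_inj) enum_rankK_in //.
by apply: imset_f; rewrite groupM.
Qed.

Definition sgn (w : {perm Phi}) : K := (-1) ^+ length pi w.

Definition kappa (H : {set {perm Phi}}) : 'M[K]_#|tabloids| :=
  \sum_(s in H) sgn s *: tabloid_repr s.

Definition polytabloid w : 'rV[K]_#|tabloids| :=
  tabloid_vec (tabloid w) *m kappa (refl_group Psi' :^ w)%g.

Definition specht : 'M[K]_#|tabloids| :=
  (\sum_(w in weyl) <<polytabloid w>>)%MS.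

Definition tabloid_form (u v : 'rV[K]_#|tabloids|) : K :=
  form idfun 1%:M u v.

Lemma tabloid_formE T1 T2 : T1 \in tabloids -> T2 \in tabloids ->
  tabloid_form (tabloid_vec T1) (tabloid_vec T2) = (T1 == T2)%:R.
Proof.
move=> T1P T2P; rewrite /tabloid_form /form mulmx1 map_mx_id // trmx_delta.
rewrite mul_delta_mx_cond -(inj_eq enum_val_inj) !enum_rankK_in //.
by case: eqP => _; rewrite ?mulr1n ?mulr0n !mxE.
Qed.

Definition specht_perp : 'M[K]_#|tabloids| := orthomx idfun 1%:M specht.

Lemma specht_perpP (u : 'rV[K]_#|tabloids|) :
  (u <= specht_perp)%MS <->
  (forall v : 'rV[K]_#|tabloids|, (v <= specht)%MS -> tabloid_form u v = 0).
Proof.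
rewrite /specht_perp /orthomx mul1mx map_mx_id // sub_kermx.
split=> [/eqP h v /submxP[c ->]|h].
  rewrite /tabloid_form /form mulmx1 map_mx_id // trmx_mul mulmxA h mul0mx.
  by rewrite mxE.
apply/eqP/rowP => i; rewrite [RHS]mxE -[RHS](h (row i specht)) ?row_sub //.
rewrite /tabloid_form /form mulmx1 map_mx_id // !mxE.
by apply: eq_bigr => j _; rewrite !mxE.
Qed.

Definition good_system : Prop :=
  useful_system pi Psi Psi' J J' /\
  (forall d : {perm Phi}, d \in weyl ->
     {in J, forall j, positive pi (d j)} ->
     [disjoint d @: Psi & Psi'] ->
     polytabloid 1%g 0 (tabloid_rank (tabloid d)) != 0).

End Tabloids.

End RootSystems.

(* Main.v *)
Require Import Defs.
From mathcomp Require Import all_boot all_order all_fingroup all_algebra.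
From mathcomp Require Import archimedean sesquilinear.
From mathcomp Require Import mxrepresentation.
From mathcomp Require Import finmap.
From mathcomp Require Import boolp reals ring.

Local Open Scope ring_scope.

(* James's submodule argument.  Let H = W(J') and kappa = kappa_{J'}.  For every
   tabloid t, t kappa is a multiple of e_{J,J'}: write t = {dJ} with d in D_Psi.
   If d Psi meets Psi', then t is fixed by a reflection of H, which makes the
   signed sum vanish; otherwise, the system being good, t = {sJ} for some s in
   H, and t kappa = +- e_{J,J'}.  As kappa is self-adjoint, a submodule U
   either contains e_{J,J'}, hence S, or is killed by kappa, hence orthogonal
   to S.  So the intersection of S and its orthogonal is a maximal submodule of
   S unless it is S itself.

   That the sign is multiplicative, equals -1 on all reflections, and that
   tabloids have representatives in D_Psi all follow from counting the positive
   roots made negative: composing with a simple reflection changes this number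
   by one. *)

(** * Reflections and the Weyl group as permutations of the roots *)

Section WeylGroup.
Set Implicit Arguments.
Unset Strict Implicit.
Import Order.TTheory GRing.Theory Num.Theory.

Variables (R : realType) (V : vectType R) (B : {dot V for idfun}).

Lemma dotC (x y : V) : B x y = B y x.
Proof. by rewrite hermC /= expr0 mul1r. Qed.

Lemma dot_root_gt0 (a : V) : a != 0 -> 0 < B a a.
Proof. exact: neq0_dnorm_gt0. Qed.

Lemma reflection_isometry (a x y : V) :
  a != 0 -> B (reflection B a x) (reflection B a y) = B x y.
Proof.
move=> /dot_root_gt0/lt0r_neq0 a0; rewrite /reflection.
rewrite linearBl !linearB /= !linearZl_LR !linearZ /= (dotC a y).
by field.
Qed.

Lemma reflection_conj (b a x : V) : b != 0 ->
  reflection B (reflection B b a) x =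
  reflection B b (reflection B a (reflection B b x)).
Proof.
move=> b0; rewrite -{1}(reflectionK B b0 x); move: (reflection B b x) => y.
rewrite {1}/reflection !reflection_isometry // /reflection.
rewrite linearBl linearZl_LR /= scalerBr scalerA opprB addrACA -!addrA.
congr (_ + _).
rewrite -!scaleNr addrA addrC -scalerDl.
by congr (_ + _ *: _); ring.
Qed.

Variable Phi : rootSystem B.
Implicit Types (a b : Phi) (Psi : {set Phi}) (D : seq Phi) (w : {perm Phi}).

Lemma tauE a b : val (tau a b) = reflection B (val a) (val b).
Proof. by rewrite permE. Qed.

Lemma tauK a : involutive (tau a).
Proof. by move=> b; rewrite !permE refl_rootK. Qed.

Lemma tauV a : ((tau a)^-1 = tau a)%g.
Proof.
by apply/permP => b; apply: (@perm_inj _ (tau a)); rewrite permKV tauK.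
Qed.

(** [tau a a] serves throughout as the opposite root: the negative in [V] does not have type
    [Phi]. *)
Lemma tau_self a : val (tau a a) = - val a.
Proof.
rewrite tauE /reflection mulfK ?lt0r_neq0 ?dot_root_gt0 ?root_neq0 //.
by rewrite scaler_nat mulr2n opprD addrA subrr add0r.
Qed.

Lemma tauN a : tau (tau a a) = tau a.
Proof.
apply/permP => b; apply: val_inj; rewrite tauE tau_self tauE /reflection.
by rewrite linearNl !linearN /= !opprK mulrN mulNr scaleNr.
Qed.

Lemma tau_tau a b : tau (tau b a) = (tau a ^ tau b)%g.
Proof.
apply/permP => c; apply: val_inj; rewrite conjgE tauV !permM !tauE.
by rewrite reflection_conj ?root_neq0.
Qed.

Lemma tau_weyl a : tau a \in weyl Phi.
Proof. by apply/mem_gen/imset_f. Qed.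

Lemma refl_group_weyl Psi : refl_group Psi \subset weyl Phi.
Proof. by apply/genS/imsetS/subsetP. Qed.

Lemma tau_refl_group Psi a : a \in Psi -> tau a \in refl_group Psi.
Proof. by move=> aP; apply/mem_gen/imset_f. Qed.

Lemma weyl_ind (P : {perm Phi} -> Prop) :
  P 1%g -> (forall w a, w \in weyl Phi -> P w -> P (w * tau a)%g) ->
  forall w, w \in weyl Phi -> P w.
Proof.
move=> P1 Pmul w /gen_prodgP[n [c cA ->]].
suff [] : (\prod_(i < n) c i)%g \in weyl Phi /\ P (\prod_(i < n) c i)%g by [].
elim: n c cA => [|n IHn] c cA; first by rewrite big_ord0.
rewrite big_ord_recr /=.
have [wP Pw] := IHn (fun i => c (widen_ord (leqnSn n) i)) (fun i => cA _).
have /imsetP[a _ ->] := cA ord_max.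
by split; [rewrite groupM ?tau_weyl | apply: Pmul].
Qed.

Lemma reflection_linear (a : V) : linear (reflection B a).
Proof.
move=> c x y; rewrite /reflection linearDl linearZl_LR /= scalerBr scalerA.
by rewrite addrACA -opprD -scalerDl; congr (_ - _ *: _); ring.
Qed.

(** Weyl group elements are mere permutations here; this recovers the linearity they inherit from
    reflections. *)
Lemma weyl_lincomb w a D (c : Phi -> R) : w \in weyl Phi ->
  val a = \sum_(b <- D) c b *: val b ->
  val (w a) = \sum_(b <- D) c b *: val (w b).
Proof.
move=> wW aE; elim/weyl_ind: w / wW => [|w b _ IHw].
  by rewrite perm1 aE; apply: eq_bigr => b _; rewrite perm1.
rewrite permM tauE IHw; under [RHS]eq_bigr do rewrite permM tauE.
elim: D {aE IHw} => [|d D IHD]; last by rewrite !big_cons reflection_linear IHD.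
by rewrite !big_nil /reflection linear0l mulr0 mul0r scale0r subr0.
Qed.

Lemma tau_weylJ w a : w \in weyl Phi -> tau (w a) = (tau a ^ w)%g.
Proof.
move=> wW; elim/weyl_ind: w / wW a => [|w b _ IHw] a; first by rewrite perm1 conjg1.
by rewrite permM tau_tau IHw conjgM.
Qed.

Lemma weyl_tau_self w a : w \in weyl Phi -> w (tau a a) = tau (w a) (w a).
Proof. by move=> /tau_weylJ->; rewrite conjgE !permM permK. Qed.

(** * Coordinates, height and positivity relative to a simple system *)

Section SimpleSystem.

Variables (Psi : {set Phi}) (D : seq Phi).
Hypotheses (subP : subsystem Psi) (simP : simple_system Psi D).

Definition simple_tuple : (size D).-tuple V := map_tuple val (in_tuple D).

Lemma free_simple_tuple : free simple_tuple.
Proof. by have [_ freeD _] := simP. Qed.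

Definition simple_coord (i : 'I_(size D)) (v : V) : R :=
  coord simple_tuple i v.

(** Since [coord] is a linear form on all of [V], height is linear without span conditions; its
    values matter only on [Psi]. *)
Definition height (v : V) : R := \sum_(i < size D) simple_coord i v.

Lemma heightB (v u : V) (c : R) : height (v - c *: u) = height v - c * height u.
Proof.
rewrite /height mulr_sumr -sumrB; apply: eq_bigr => i _.
by rewrite /simple_coord linearB linearZ.
Qed.

Lemma heightN (v : V) : height (- v) = - height v.
Proof. by rewrite -sumrN; apply: eq_bigr => i _; rewrite /simple_coord linearN. Qed.

Lemma simple_coord_tnth i j :
  simple_coord i (val (tnth (in_tuple D) j)) = (i == j)%:R.
Proof.
rewrite /simple_coord eq_sym -[RHS](coord_free j i free_simple_tuple).
by rewrite -tnth_nth tnth_map.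
Qed.

(** Freeness makes the coefficients unique, so the nonnegative ones that are given must be the
    coordinates. *)
Lemma nonneg_comb_coord (v : V) : nonneg_comb D v ->
  v = \sum_i simple_coord i v *: val (tnth (in_tuple D) i) /\
  forall i, 0 <= simple_coord i v.
Proof.
move=> [c c0 vE].
have vE' : v = \sum_(i < size D) c (tnth (in_tuple D) i) *: val (tnth (in_tuple D) i).
  by rewrite vE big_tnth.
have coE i : simple_coord i v = c (tnth (in_tuple D) i).
  rewrite vE' /simple_coord linear_sum (bigD1 i) //= linearZ /=.
  rewrite -/(simple_coord i _) simple_coord_tnth eqxx mulr1 big1 ?addr0 // => j ji.
  rewrite linearZ /= -/(simple_coord i _) simple_coord_tnth eq_sym (negPf ji).
  by rewrite mulr0.
split=> [|i]; last by rewrite coE c0 // mem_tnth.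
by rewrite {1}vE'; apply: eq_bigr => i _; rewrite coE.
Qed.

Lemma root_expansion b : b \in Psi ->
  val b = \sum_i simple_coord i (val b) *: val (tnth (in_tuple D) i).
Proof.
have [_ _ posD] := simP; move=> /posD[] /nonneg_comb_coord[] // + _.
move=> /(congr1 -%R); rewrite opprK -sumrN => {1}->.
by apply: eq_bigr => i _; rewrite /simple_coord linearN scaleNr opprK.
Qed.

(** A boolean form of positivity: the coordinates of a root of [Psi] share a sign, which the height
    therefore detects. *)
Definition pos b : bool := 0 < height (val b).

Lemma simple_coords_neq0 b : b \in Psi -> (forall i, simple_coord i (val b) = 0) -> False.
Proof.
move=> bP h; have /eqP := root_neq0 b; apply.
by rewrite root_expansion // big1 // => i _; rewrite h scale0r.
Qed.

Lemma pos_coord b i : b \in Psi -> pos b -> 0 <= simple_coord i (val b).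
Proof.
have [_ _ posD] := simP; move=> bP.
case: (posD b bP) => /nonneg_comb_coord[_ h] //.
rewrite /pos ltNge => /negP[]; rewrite -oppr_ge0 -heightN.
exact: sumr_ge0.
Qed.

Lemma npos_coord b i : b \in Psi -> ~~ pos b -> simple_coord i (val b) <= 0.
Proof.
have [_ _ posD] := simP; move=> bP.
case: (posD b bP) => /nonneg_comb_coord[_ h]; last first.
  by move=> _; move: (h i); rewrite /simple_coord linearN oppr_ge0.
rewrite /pos -leNgt => h0.
(* Nonnegative coordinates with nonpositive sum all vanish. *)
have /eqP : height (val b) = 0 by apply/eqP; rewrite eq_le h0 sumr_ge0.
by rewrite psumr_eq0 // => /allP/(_ i (mem_index_enum i))/eqP->.
Qed.

Lemma nonneg_comb_pos b : b \in Psi -> nonneg_comb D (val b) -> pos b.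
Proof.
move=> bP /nonneg_comb_coord[_ h]; rewrite /pos lt0r sumr_ge0 // andbT.
rewrite psumr_eq0 //; apply/negP => /allP h0; apply: (simple_coords_neq0 bP) => i.
exact/eqP/h0/mem_index_enum.
Qed.

Lemma pos_nonneg_comb b : b \in Psi -> pos b -> nonneg_comb D (val b).
Proof.
have [_ _ posD] := simP; move=> bP; case: (posD b bP) => // /nonneg_comb_coord[_ h].
rewrite /pos ltNge => /negP[]; rewrite -oppr_ge0 -heightN.
exact: sumr_ge0.
Qed.

Lemma height_neq0 b : b \in Psi -> height (val b) != 0.
Proof.
have [_ _ posD] := simP; move=> bP; apply/eqP => h0.
have bpos : ~~ pos b by rewrite /pos h0 ltxx.
have : height (val b) == 0 by rewrite h0.
rewrite -oppr_eq0 -sumrN psumr_eq0 => [/allP h|i _]; last first.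
  by rewrite oppr_ge0 npos_coord.
apply: (simple_coords_neq0 bP) => i; apply/eqP; rewrite -oppr_eq0.
exact/h/mem_index_enum.
Qed.

Lemma posN b : b \in Psi -> pos (tau b b) = ~~ pos b.
Proof.
move=> /height_neq0 h0; rewrite /pos tau_self heightN oppr_gt0 lt_neqAle h0 /=.
by rewrite leNgt.
Qed.

Lemma simple_pos a : a \in D -> pos a.
Proof.
have [sD _ _] := simP; move=> aD; apply: nonneg_comb_pos; first exact: sD.
exists (fun b => (b == a)%:R); first by move=> b _; rewrite ler0n.
have [_ /free_uniq/map_uniq uD _] := simP.
rewrite (bigD1_seq a) //= eqxx scale1r big1 ?addr0 // => b /negPf->.
by rewrite scale0r.
Qed.

Lemma height_simple a : a \in D -> height (val a) = 1.
Proof.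
move=> /(tnthP (in_tuple D))[i ->]; rewrite /height (bigD1 i) //=.
rewrite simple_coord_tnth eqxx big1 ?addr0 // => j ji.
by rewrite simple_coord_tnth (negPf ji).
Qed.

Lemma subsystem_tau a b : a \in Psi -> b \in Psi -> tau a b \in Psi.
Proof.
have [_ _ + _ _] := subP; move=> h aP bP.
by rewrite -mem_vecs tauE h // mem_vecs.
Qed.

(* [tau a] changes only the coordinate along [a], so a positive root that it
   makes negative is a positive multiple of [a]. *)
Lemma tau_simple_pos a b :
  a \in D -> b \in Psi -> b != a -> pos b -> pos (tau a b).
Proof.
have [sD _ _] := simP; move=> aD bP ba bpos; apply: contraNT ba => nbpos.
have aP := sD a aD.
have [_ _ _ red _] := rootsP Phi.
have [j aE] := tnthP (in_tuple D) a aD.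
have b0 i : i != j -> simple_coord i (val b) = 0.
  move=> ij; apply/eqP; rewrite eq_le pos_coord // andbT.
  have ai : simple_coord i (val a) = 0.
    by rewrite aE simple_coord_tnth (negPf ij).
  have := npos_coord i (subsystem_tau aP bP) nbpos.
  rewrite tauE /reflection /simple_coord linearB linearZ /= -!/(simple_coord i _).
  by rewrite ai mulr0 subr0.
have bE : val b = simple_coord j (val b) *: val a.
  rewrite {1}(root_expansion bP) (bigD1 j) //= -aE big1 ?addr0 // => i ij.
  by rewrite b0 // scale0r.
have [] := red (val a) (valP a) (simple_coord j (val b)).
- by rewrite -bE; apply: valP.
- by move=> c1; apply/eqP/val_inj; rewrite bE c1 scale1r.
move=> c1; have := pos_coord j bP bpos; rewrite c1.
by rewrite lerNr oppr0 ler10.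
Qed.

(** Otherwise expanding one argument of B(b, b) over [D], with nonnegative coordinates, would give a
    nonpositive value. *)
Lemma pos_acute_simple b : b \in Psi -> pos b ->
  exists2 a, a \in D & 0 < B (val b) (val a).
Proof.
move=> bP bpos.
have [/existsP[i hi]|/existsPn hn] :=
  boolP [exists i, 0 < B (val b) (val (tnth (in_tuple D) i))].
  by exists (tnth (in_tuple D) i) => //; apply: mem_tnth.
have := dot_root_gt0 (root_neq0 b).
rewrite {2}(root_expansion bP) linear_sum /= ltNge => /negP[].
apply: sumr_le0 => i _; rewrite linearZ /= mulr_ge0_le0 ?pos_coord //.
by rewrite leNgt hn.
Qed.

End SimpleSystem.

(** * Counting the positive roots made negative *)

Definition inversions (Psi : {set Phi}) (D pi : seq Phi) w : {set Phi} :=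
  [set b in Psi | pos D b & ~~ pos pi (w b)].

Section WeylSign.

Variable pi : seq Phi.
Hypothesis piP : simple_system [set: Phi] pi.

Lemma subsystemT : subsystem [set: Phi].
Proof.
have vP (v : V) : v \in vecs [set: Phi] -> v \in Defs.roots Phi.
  by move=> /imageP[a _ ->]; apply: valP.
have [_ n0 _ hred hcrys] := rootsP Phi.
split=> //.
- by apply: contra n0 => /vP.
- move=> _ _ /imageP[a _ ->] /imageP[b _ ->].
  by rewrite -tauE mem_vecs inE.
- by move=> a /vP aP c /vP bP; apply: hred bP.
- by move=> a b /vP aP /vP bP; apply: hcrys.
Qed.

Section Inversions.

Variables (Psi : {set Phi}) (D : seq Phi).
Hypotheses (subP : subsystem Psi) (simP : simple_system Psi D).

(** The root a is an inversion of [tau a * w] but not of w, and [tau a] matches the remaining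
    inversions of the former with those of the latter. *)
Lemma card_inversions_tau w a : w \in weyl Phi -> a \in D -> pos pi (w a) ->
  #|inversions Psi D pi (tau a * w)| = #|inversions Psi D pi w|.+1.
Proof.
move=> wW aD wa; have [sD _ _] := simP; have aP := sD a aD.
have apos := simple_pos simP aD.
rewrite (cardsD1 a) !inE aP apos permM weyl_tau_self // (posN piP) ?inE // wa /=.
rewrite add1n -[in RHS](card_imset _ (@perm_inj _ (tau a))); congr _.+1.
apply/eq_card => b; apply/idP/imsetP => [|[c + ->]]; rewrite !inE permM.
  move=> /and4P[ba bP bpos wb]; exists (tau a b); last by rewrite tauK.
  by rewrite !inE subsystem_tau //= wb (tau_simple_pos subP simP).
rewrite tauK => /and3P[cP cpos wc]; rewrite wc subsystem_tau // andbT /=.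
rewrite (tau_simple_pos subP simP) // ?andbT; last by apply: contraNneq wc => ->.
apply: contraTneq cpos => ca; rewrite -(tauK a c) ca (posN simP) //.
by rewrite apos.
Qed.

Lemma card_inversions_tauN w a : w \in weyl Phi -> a \in D -> ~~ pos pi (w a) ->
  #|inversions Psi D pi w| = #|inversions Psi D pi (tau a * w)|.+1.
Proof.
move=> wW aD wa; rewrite -(card_inversions_tau _ aD) ?groupM ?tau_weyl //.
  by rewrite mulgA -{1}(tauV a) mulVg mul1g.
by rewrite permM weyl_tau_self // (posN piP) ?inE.
Qed.

(** Take r with the fewest inversions of [r * w] inside [Psi]: a simple root of [D] made negative
    would let [tau a * r] do better. This yields row representatives in D_Psi. *)
Lemma refl_group_pos_translate w : w \in weyl Phi ->
  exists2 r, r \in refl_group Psi & {in D, forall a, pos pi (w (r a))}.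
Proof.
move=> wW; pose N r := #|inversions Psi D pi (r * w)|.
case: (arg_minnP N (group1 (refl_group Psi))) => r rP rmin.
exists r => // a aD; apply: contraT => wa.
have [sD _ _] := simP; have aP := tau_refl_group (sD a aD).
have rW := subsetP (refl_group_weyl Psi) r rP.
have := rmin (tau a * r)%g (groupM aP rP).
rewrite /N -mulgA (@card_inversions_tauN (r * w) a) ?groupM ?ltnn //.
by rewrite permM.
Qed.

End Inversions.

(** * Generation by simple reflections and parity of the length *)

Definition simple_refl_group : {group {perm Phi}} :=
  [group of <<[set tau a | a in pi]>>%g].

Lemma tau_simple_refl_group a : a \in pi -> tau a \in simple_refl_group.
Proof. by move=> api; apply/mem_gen/imset_f. Qed.

(* A positive non-simple root makes an acute angle with some simple root, whose
   reflection then lowers its height: a minimal counterexample is simple. *)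
Lemma tau_simple_class b :
  exists2 a, a \in pi & tau b \in (tau a ^: simple_refl_group)%g.
Proof.
pose P b := pos pi b && ~~ has (fun a => tau b \in tau a ^: simple_refl_group)%g pi.
suff nP c : ~~ P c.
  (* Opposite roots have the same reflection, so b may be taken positive. *)
  apply/hasP; wlog bpos : b / pos pi b => [wlog|].
    have [/wlog //|nbpos] := boolP (pos pi b).
    by rewrite -tauN wlog // (posN piP) ?inE.
  by have := nP b; rewrite negb_and bpos negbK.
apply/negP => Pc.
case: (@Order.TotalTheory.arg_minP _ _ _ c P (fun b => height pi (val b)) Pc).
move=> {Pc}c /andP[cpos nc] cmin.
have [a api ca] := pos_acute_simple piP (in_setT c) cpos.
have ac : c != a.
  by apply: contraNneq nc => ->; apply/hasP; exists a => //; apply: class_refl.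
have Pac : P (tau a c).
  rewrite /P (tau_simple_pos subsystemT piP) ?inE //= tau_tau.
  apply: contra nc => /hasP[d dpi cd]; apply/hasP; exists d => //.
  have [g gG /(canRL (conjgK _))->] := imsetP cd.
  by rewrite -conjgM memJ_class // groupM ?groupV ?tau_simple_refl_group.
have := cmin _ Pac; rewrite tauE /reflection heightB (height_simple piP api) mulr1.
rewrite lerBrDr gerDl leNgt => /negP[].
by rewrite divr_gt0 ?mulr_gt0 ?dot_root_gt0 ?root_neq0.
Qed.

Lemma weyl_simple_refl_group : weyl Phi \subset simple_refl_group.
Proof.
rewrite gen_subG; apply/subsetP => _ /imsetP[b _ ->].
have [a api /imsetP[g gW ->]] := tau_simple_class b.
by rewrite groupJ ?tau_simple_refl_group.
Qed.

Lemma weyl_simple_word w : w \in weyl Phi -> exists k, simple_word pi w k.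
Proof.
move=> /(subsetP weyl_simple_refl_group)/gen_prodgP[n [c cA ->]]; exists n; rewrite /simple_word.
elim: n c cA => [|n IHn] c cA; first by rewrite big_ord0 expg0 inE.
by rewrite big_ord_recl expgS mem_mulg ?IHn.
Qed.

Lemma simple_word_weyl w k : simple_word pi w k -> w \in weyl Phi.
Proof.
rewrite /simple_word; elim: k w => [|k IHk] w.
  by rewrite expg0 inE => /eqP->; apply: group1.
rewrite expgS => /mulsgP[_ v /imsetP[a _ ->] /IHk vW ->].
by rewrite groupM ?tau_weyl.
Qed.

(** Each letter changes the inversion count by one, so all words for w have lengths of the same
    parity. *)
Lemma odd_simple_word w k : simple_word pi w k ->
  odd #|inversions setT pi pi w| = odd k.
Proof.
rewrite /simple_word; elim: k w => [|k IHk] w.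
  rewrite expg0 inE => /eqP->; rewrite (_ : inversions _ _ _ _ = set0) ?cards0 //.
  by apply/setP => b; rewrite !inE perm1 andbN.
rewrite expgS => /mulsgP[_ v /imsetP[a api ->] vk ->]; rewrite /= -(IHk v vk).
have vW := simple_word_weyl vk.
have [va|va] := boolP (pos pi (v a)).
  by rewrite (card_inversions_tau subsystemT piP).
by rewrite [in RHS](card_inversions_tauN subsystemT piP vW api va) /= negbK.
Qed.

Lemma odd_length w k : simple_word pi w k -> odd (length pi w) = odd k.
Proof.
move=> wk; rewrite -(odd_simple_word wk) /length.
case: pselect => [h|[]]; last by exists k.
by case: ex_minnP => m /odd_simple_word-> _.
Qed.

Lemma odd_lengthM : {in weyl Phi &, forall w v,
  odd (length pi (w * v)%g) = odd (length pi w) (+) odd (length pi v)}.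
Proof.
move=> w v /weyl_simple_word[k wk] /weyl_simple_word[m vm].
rewrite (odd_length wk) (odd_length vm) -oddD; apply: odd_length.
by rewrite /simple_word expgD mem_mulg.
Qed.

Lemma odd_length1 : odd (length pi 1%g) = false.
Proof. by apply: (@odd_length _ 0); rewrite /simple_word expg0 inE. Qed.

Lemma odd_lengthJ : {in weyl Phi &, forall w v,
  odd (length pi (w ^ v)%g) = odd (length pi w)}.
Proof.
move=> w v wW vW; rewrite conjgE !odd_lengthM ?groupM ?groupV //.
by rewrite addbCA -(odd_lengthM (groupVr vW) vW) mulVg odd_length1 addbF.
Qed.

Lemma odd_length_tau a : odd (length pi (tau a)).
Proof.
have [b bpi /imsetP[v vG ->]] := tau_simple_class a.
have vW : v \in weyl Phi.
  apply: subsetP vG; rewrite gen_subG; apply/subsetP => _ /imsetP[c _ ->].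
  exact: tau_weyl.
rewrite odd_lengthJ ?tau_weyl // (@odd_length _ 1) //.
by rewrite /simple_word expg1 imset_f.
Qed.

End WeylSign.
End WeylGroup.

(** * Tabloids as cosets of W(J) *)

Section GeneralizedSpecht.
Set Implicit Arguments.
Unset Strict Implicit.
Import Order.TTheory GRing.Theory Num.Theory.

Variables (R : realType) (V : vectType R) (B : {dot V for idfun}).
Variables (Phi : rootSystem B) (pi : seq Phi) (Psi Psi' : {set Phi}).
Variables (J J' : seq Phi) (K : fieldType).
Implicit Types (w s r : {perm Phi}).

Local Arguments repr_mx : simpl never.

Hypotheses (piP : simple_system [set: Phi] pi).
Hypotheses (subP : subsystem Psi) (simP : simple_system Psi J).

Local Notation tabloid := (tabloid Psi J J').
Local Notation tableau := (tableau J J').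
Local Notation tabloid_vec := (tabloid_vec K Psi (J := J) (J' := J')).
Local Notation rho := (tabloid_repr K Psi J J').
Local Notation kappa := (kappa K pi Psi J J').
Local Notation polytabloid := (polytabloid K pi Psi Psi' J J').
Local Notation specht := (specht K pi Psi Psi' J J').
Local Notation specht_perp := (specht_perp K pi Psi Psi' J J').
Local Notation sgn := (sgn K pi).
Local Notation W := (weyl Phi).
Local Notation H := (refl_group Psi').

Lemma refl_groupJ (A : {set Phi}) w : w \in W ->
  (refl_group A :^ w = <<[set tau (w a) | a in A]>>)%g.
Proof.
move=> wW; rewrite /= -genJ; congr (<<_>>)%g.
rewrite /conjugate -imset_comp; apply: eq_in_imset => a _ /=.
by rewrite tau_weylJ.
Qed.

(** A tableau records the images of [J], and every root of [Psi] is a linear combination of [J]. *)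
Lemma tableau_eq_in w1 w2 : w1 \in W -> w2 \in W ->
  tableau w1 = tableau w2 -> {in Psi, w1 =1 w2}.
Proof.
move=> w1W w2W /(congr1 val)/= /eq_in_map eJ b bP.
have {}eJ : {in J, w1 =1 w2} by move=> a aJ; apply: eJ; rewrite mem_cat aJ.
have [_ _ /(_ b bP) combP] := simP.
suff [c cE] : exists c : Phi -> R, val b = \sum_(a <- J) c a *: val a.
  apply: val_inj; rewrite (weyl_lincomb w1W cE) (weyl_lincomb w2W cE).
  by rewrite !big_seq; apply: eq_bigr => a /eJ->.
case: combP => -[c _ cE]; first by exists c.
exists (fun a => - c a); rewrite -[LHS]opprK cE -sumrN.
by apply: eq_bigr => a _; rewrite scaleNr.
Qed.

Lemma tableauM w s : act_tableau s (tableau w) = tableau (w * s)%g.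
Proof. by rewrite /Defs.tableau act_tableauM. Qed.

(* [row_equiv] quantifies over all [w1] representing the first tableau; by
   [tableau_eq_in] the group [W(w1 J)] does not depend on this choice. *)
Lemma tabloidP w t : w \in W ->
  reflect (exists2 r, r \in refl_group Psi & t = tableau (r * w)%g)
          (t \in tabloid w).
Proof.
move=> wW; rewrite inE; apply: (iffP andP) => [[_]|[r rP ->]].
  move=> /exists_inP[w1 w1W /exists_inP[w2 w2W /and3P[/eqP e1 /eqP->]]].
  move=> /exists_inP[g + /eqP->]; rewrite -e1.
  have -> : (refl_group Psi :^ w1)%g = (refl_group Psi :^ w)%g.
    rewrite !refl_groupJ //; congr (<<_>>)%g; apply: eq_in_imset => a aP.
    by rewrite (tableau_eq_in wW w1W e1).
  move=> /imsetP[r rP ->]; exists r => //.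
  by rewrite tableauM -conjgC.
have rW := subsetP (refl_group_weyl Psi) r rP.
split; first by rewrite imset_f ?groupM.
apply/exists_inP; exists w => //; apply/exists_inP; exists (r * w)%g.
  by rewrite groupM.
rewrite !eqxx /=; apply/exists_inP; exists (r ^ w)%g; first by rewrite memJ_conjg.
by rewrite tableauM -conjgC.
Qed.

(** As a map, [r * w] is w after r, that is, the conjugate of r by w applied after w: a row
    equivalence. *)
Lemma tabloid_translate r w : r \in refl_group Psi -> w \in W ->
  tabloid (r * w)%g = tabloid w.
Proof.
move=> rP wW; have rW := subsetP (refl_group_weyl Psi) r rP.
apply/setP => t; apply/tabloidP/tabloidP => //; first by rewrite groupM.
  by move=> [g gP ->]; exists (g * r)%g; rewrite ?groupM ?mulgA.
move=> [g gP ->]; exists (g * r^-1)%g; first by rewrite groupM ?groupV.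
by rewrite mulgA mulgKV.
Qed.

(** * The sign character and the signed sum *)

Lemma sgnE w : sgn w = (-1) ^+ odd (length pi w).
Proof. by rewrite signr_odd. Qed.

Lemma sgnM : {in W &, {morph sgn : w s / (w * s)%g >-> w * s}}.
Proof. by move=> w s wW sW; rewrite !sgnE odd_lengthM // signr_addb. Qed.

Lemma sgnJ : {in W &, forall w s, sgn (w ^ s)%g = sgn w}.
Proof. by move=> w s wW sW; rewrite !sgnE odd_lengthJ. Qed.

Lemma sgnV w : w \in W -> sgn w^-1%g = sgn w.
Proof.
move=> wW; have := sgnM wW (groupVr wW); rewrite mulgV sgnE (odd_length1 piP).
rewrite (sgnE w) => /(canLR (signrMK _)); rewrite mulr1 => <- //.
Qed.

Lemma repr_sgn_kappa s : s \in H -> rho s *m kappa H = sgn s *: kappa H.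
Proof.
move=> sH; have HW x := subsetP (refl_group_weyl Psi') x.
rewrite /kappa [in RHS](reindex_inj (mulgI s)) mulmx_sumr scaler_sumr.
rewrite [in RHS](eq_bigl (mem H)) => [|x]; last by rewrite /= groupMl.
apply: eq_bigr => x xH; rewrite -scalemxAr -repr_mxM ?HW // scalerA; congr (_ *: _).
by rewrite sgnM ?HW // mulrA !sgnE -signr_addb addbb mul1r.
Qed.

(** The sign is a class function, so conjugating the group conjugates its signed sum. *)
Lemma kappaJ s : s \in W -> forall w, w \in W ->
  kappa (H :^ (w * s))%g = rho s^-1%g *m kappa (H :^ w)%g *m rho s.
Proof.
move=> sW w wW; rewrite conjsgM {1}/Defs.kappa big_imset /=; last first.
  by move=> x y _ _; apply: conjg_inj.
have HW x : x \in (H :^ w)%g -> x \in W.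
  by apply: subsetP; rewrite -(conjGid wW) conjSg refl_group_weyl.
rewrite mulmx_sumr mulmx_suml; apply: eq_bigr => x /HW xW.
rewrite -scalemxAr -scalemxAl sgnJ // conjgE.
by rewrite -!repr_mxM ?groupM ?groupV // mulgA.
Qed.

Lemma polytabloidM w s : w \in W -> s \in W ->
  polytabloid w *m rho s = polytabloid (w * s)%g.
Proof.
move=> wW sW; rewrite /Defs.polytabloid (kappaJ sW wW) -(tabloid_vec_act K Psi J J' sW wW).
by rewrite !mulmxA repr_mxK.
Qed.

Lemma polytabloid1 : polytabloid 1%g = tabloid_vec (tabloid 1%g) *m kappa H.
Proof. by rewrite /Defs.polytabloid conjsg1. Qed.

Lemma polytabloidE w : w \in W -> polytabloid w = polytabloid 1%g *m rho w.
Proof. by move=> wW; rewrite polytabloidM ?mul1g. Qed.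

(* The elements of [H] are paired by left multiplication with [tau a], which
   changes their sign: this avoids dividing by 2. *)
Lemma kappa_fixed0 (v : 'rV[K]_#|tabloids Psi J J'|) a : a \in Psi' ->
  v *m rho (tau a) = v -> v *m kappa H = 0.
Proof.
move=> /tau_refl_group aH va; have HW x := subsetP (refl_group_weyl Psi') x.
have aW := HW _ aH.
rewrite /Defs.kappa (bigID (fun x => odd (length pi x))) /=.
rewrite (reindex_inj (mulgI (tau a))) /=.
rewrite [X in X + _](@eq_bigl _ _ _ _ _ _
  (fun x => (x \in H) && ~~ odd (length pi x))); last first.
  move=> x; rewrite groupMl //; have [xH|//] := boolP (x \in H).
  by rewrite (odd_lengthM piP) ?HW // odd_length_tau.
rewrite -big_split /= mulmx_sumr big1 // => x /andP[xH xodd].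
rewrite sgnM ?HW // repr_mxM ?HW // mulmxDr -!scalemxAr mulmxA va -scalerDl.
by rewrite (sgnE (tau a)) (odd_length_tau piP) mulN1r addNr scale0r.
Qed.

(** * Adjoints for the form *)

Lemma tr_repr s : s \in W -> (rho s)^T = rho s^-1%g.
Proof.
move=> sW; apply/matrixP => i j; rewrite !mxE; congr (nat_of_bool _)%:R.
by apply/eqP/eqP => <-; rewrite -act_tabloidM ?mulgV ?mulVg act_tabloid1.
Qed.

(** Transposition inverts group elements, which permutes [H] and preserves signs. *)
Lemma tr_kappa : (kappa H)^T = kappa H.
Proof.
rewrite /Defs.kappa linear_sum [RHS](reindex_inj invg_inj) /=.
rewrite [RHS](eq_bigl (mem H)) => [|x]; last by rewrite /= groupV.
apply: eq_bigr => x /(subsetP (refl_group_weyl Psi')) xW.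
by rewrite linearZ /= sgnV // -tr_repr.
Qed.

Lemma tabloid_formMr (u v : 'rV[K]_#|tabloids Psi J J'|) (A : 'M[K]_#|tabloids Psi J J'|) :
  tabloid_form u (v *m A) = tabloid_form (u *m A^T) v.
Proof.
by rewrite /tabloid_form /form !mulmx1 !map_mx_id // trmx_mul mulmxA.
Qed.

(** * The signed sum maps the tabloid module into the line of e_{J,J'} *)

Hypothesis goodP : forall d, d \in W -> {in J, forall j, positive pi (d j)} ->
  [disjoint d @: Psi & Psi'] ->
  polytabloid 1%g 0 (tabloid_rank Psi (tabloid d)) != 0.

Lemma tabloid_vec_kappa w : w \in W ->
  (tabloid_vec (tabloid w) *m kappa H <= polytabloid 1%g)%MS.
Proof.
move=> wW; have HW x := subsetP (refl_group_weyl Psi') x.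
have [r rP rJ] := refl_group_pos_translate piP subP simP wW.
have rW := subsetP (refl_group_weyl Psi) r rP.
rewrite -(tabloid_translate rP wW); set d := (r * w)%g.
have dW : d \in W by rewrite groupM.
have [disj|] := boolP [disjoint d @: Psi & Psi'].
  have dpos : {in J, forall j, positive pi (d j)}.
    by move=> a aJ; apply: (pos_nonneg_comb piP); rewrite ?inE // permM rJ.
  have [s sH sd] : exists2 s, s \in H & tabloid s = tabloid d.
    suff /exists_inP[s sH /eqP sd] : [exists s in H, tabloid s == tabloid d].
      by exists s.
    (* e_{J,J'} is a signed sum of the tabloids of elements of [H]; if none were that of d, its
       coefficient there would be zero. *)
    apply: contraT => /exists_inPn nd.
    have /negP[] := goodP dW dpos disj; apply/eqP.
    rewrite polytabloid1 /Defs.kappa mulmx_sumr summxE big1 // => s sH.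
    rewrite -scalemxAr tabloid_vec_act ?group1 ?HW // mul1g !mxE eqxx /=.
    case: eqP => [e|]; last by rewrite mulr0.
    case/negP: (nd s sH); apply/eqP.
    (* Ranks separate genuine tabloids only, since other sets receive a default index. *)
    apply: (can_in_inj (enum_rankK_in (tabloid1_mem Psi J J'))); last exact: esym.
      by apply: imset_f; apply: HW.
    exact: imset_f.
  rewrite -sd -[s]mul1g -tabloid_vec_act ?group1 ?HW // -mulmxA repr_sgn_kappa //.
  by rewrite -scalemxAr scalemx_sub // polytabloid1.
(* Here a lies in [Psi] and d(a) in [Psi']; the reflection in d(a) is the conjugate of [tau a] by d,
   so it fixes the tabloid of d. *)
rewrite -setI_eq0 => /set0Pn[_ /setIP[/imsetP[a aP ->] daP']].
rewrite (kappa_fixed0 daP') ?sub0mx //.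
rewrite tabloid_vec_act ?tau_weyl // tau_weylJ // -conjgC tabloid_translate //.
exact: tau_refl_group.
Qed.

Lemma mulmx_kappa_sub (v : 'rV[K]_#|tabloids Psi J J'|) :
  (v *m kappa H <= polytabloid 1%g)%MS.
Proof.
rewrite mulmx_sum_row; apply: summx_sub => i _; apply: scalemx_sub.
have /imsetP[w wW iE] := enum_valP i.
have -> : row i (kappa H) = tabloid_vec (tabloid w) *m kappa H.
  by rewrite rowE /Defs.tabloid_vec -iE /tabloid_rank enum_valK_in.
exact: tabloid_vec_kappa.
Qed.

(** * The Specht module, its orthogonal, and the submodule dichotomy *)

Lemma polytabloid_specht w : w \in W -> (polytabloid w <= specht)%MS.
Proof. by move=> wW; rewrite (sumsmx_sup w) // genmxE. Qed.

Lemma specht_sub m (A : 'M[K]_(m, #|tabloids Psi J J'|)) :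
  (forall w, w \in W -> (polytabloid w <= A)%MS) -> (specht <= A)%MS.
Proof. by move=> h; apply/sumsmx_subP => w wW; rewrite genmxE h. Qed.

Lemma specht_module : mxmodule rho specht.
Proof.
apply/mxmoduleP => s sW; rewrite sumsmxMr; apply/sumsmx_subP => w wW.
by rewrite (eqmxMr _ (genmxE _)) polytabloidM // polytabloid_specht ?groupM.
Qed.

(** The vectors orthogonal to u form a subspace, the kernel of its transpose, so testing on
    generators suffices. *)
Lemma sub_specht_perp (u : 'rV[K]_#|tabloids Psi J J'|) :
  (forall w, w \in W -> tabloid_form u (polytabloid w) = 0) ->
  (u <= specht_perp)%MS.
Proof.
have formE v : tabloid_form u v = (v *m u^T) 0 0.
  by rewrite -[v *m _]trmxK trmx_mul trmxK mxE /tabloid_form /form mulmx1 map_mx_id.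
move=> h; apply/specht_perpP => v vS; rewrite formE.
have /(submx_trans vS) : (specht <= kermx u^T)%MS.
  apply: specht_sub => w wW; rewrite sub_kermx; apply/eqP/rowP => i.
  by rewrite ord1 -formE h // mxE.
by rewrite sub_kermx => /eqP->; rewrite mxE.
Qed.

Lemma specht_perp_module : mxmodule rho specht_perp.
Proof.
apply/mxmoduleP => s sW; apply/row_subP => i; rewrite row_mul.
apply: sub_specht_perp => w wW.
rewrite -[rho s]trmxK -tabloid_formMr tr_repr // polytabloidM ?groupV //.
have /specht_perpP-> // : (row i specht_perp <= specht_perp)%MS by apply: row_sub.
by rewrite polytabloid_specht ?groupM ?groupV.
Qed.

Lemma mxmodule_kappa m (U : 'M[K]_(m, #|tabloids Psi J J'|)) :
  mxmodule rho U -> (U *m kappa H <= U)%MS.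
Proof.
move=> /mxmoduleP modU; rewrite /Defs.kappa mulmx_sumr.
apply: summx_sub => s /(subsetP (refl_group_weyl Psi')) sW.
by rewrite -scalemxAr scalemx_sub ?modU.
Qed.

Lemma specht_sub_or_perp m (U : 'M[K]_(m, #|tabloids Psi J J'|)) :
  mxmodule rho U -> (specht <= U)%MS \/ (U <= specht_perp)%MS.
Proof.
move=> modU; have /mxmoduleP actU := modU.
have [/eqP Uk0|/rowV0Pn/=[_ /submxP[x ->] xk0]] := boolP (U *m kappa H == 0).
  (* Moving w and then the signed sum across the form leaves a vector of [U] times [kappa H], which
     is zero. *)
  right; apply/row_subP => i; apply: sub_specht_perp => w wW.
  rewrite polytabloidE // tabloid_formMr tr_repr // polytabloid1 tabloid_formMr.
  have /submxP[y ->] : (row i U *m rho w^-1%g <= U)%MS.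
    by rewrite -row_mul (submx_trans (row_sub _ _)) // actU ?groupV.
  by rewrite tr_kappa -mulmxA Uk0 mulmx0 /tabloid_form /form !mul0mx mxE.
left; apply: specht_sub => w wW; rewrite polytabloidE //.
apply: submx_trans (actU w wW); apply: submxMr.
have : (x *m U *m kappa H <= polytabloid 1%g)%MS := mulmx_kappa_sub _.
(* A nonzero vector of [U *m kappa H] is c times e_{J,J'} with c nonzero; dividing by c puts
   e_{J,J'} in [U]. *)
rewrite -mulmxA => /sub_rVP[c cE].
have c0 : c != 0 by apply: contraNneq xk0 => c0; rewrite cE c0 scale0r.
have -> : polytabloid 1%g = c^-1 *: (x *m (U *m kappa H)).
  by rewrite cE scalerA mulVf ?scale1r.
by rewrite scalemx_sub // (submx_trans (submxMl _ _)) // mxmodule_kappa.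
Qed.

End GeneralizedSpecht.

(* The existential quantifiers range over proofs that the two subspaces are
   submodules, which the section module needs. *)
Theorem theorem3p23 (R : realType) (V : vectType R) (B : {dot V for idfun})
    (Phi : rootSystem B) (pi : seq Phi) (Psi Psi' : {set Phi})
    (J J' : seq Phi) (K : fieldType) :
  simple_system [set: Phi] pi ->
  good_system K pi Psi Psi' J J' ->
  let M := tabloid_repr K Psi J J' in
  let S := specht K pi Psi Psi' J J' in
  let Sperp := specht_perp K pi Psi Psi' J J' in
  exists (modS : mxmodule M S) (modN : mxmodule M (S :&: Sperp)%MS),
    let D := section_repr modN modS in
    \rank (in_factmod (S :&: Sperp)%MS S) = 0%N \/ mx_irreducible D.
Proof.
move=> piP [[subP _ simP _ _ _ _ _ _ _] goodP] M S Sperp.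
have modS : mxmodule M S by apply: specht_module.
have modN : mxmodule M (S :&: Sperp)%MS.
  by rewrite capmx_module ?specht_perp_module.
exists modS, modN => D.
have [SN|nSN] := boolP (S <= S :&: Sperp)%MS.
  by left; apply/eqP; rewrite mxrank_eq0 in_factmod_eq0.
(* The quotient is irreducible exactly when the submodule is maximal; the dichotomy excludes any [U]
   strictly between. *)
right; apply/max_submodP; first exact: capmxSl.
split=> [|U [modU ltNU ltUS]]; first by rewrite /ltmx capmxSl.
have [SU|UP] := specht_sub_or_perp piP subP simP goodP modU.
  by move: ltUS; rewrite /ltmx SU andbF.
by move: ltNU; rewrite /ltmx sub_capmx UP (ltmxW ltUS) andbF.
Qed.
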